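(* Let $q$ be a prime. For any $j\in\mathbb{F}_q^{*}$ and any positive integer $N\le q$, let $T_{4,2}(N;j,q)$ denote the number of $8$-tuples $(b_1,\ldots,b_8)\in\mathbb{F}_q^8$ such that $$b_1+b_2+b_3+b_4=b_5+b_6+b_7+b_8 \quad\text{and}\quad b_i^2\in\{j,2j,\ldots,Nj\}\subseteq \mathbb{F}_q,\qquad i=1,\ldots,8.$$ Then $$ T_{4,2}(N;j,q) \le \left(\frac{N^{5/8}}{q^{1/8}}+\frac{N^{8}}{q^{1/2}}\right)N^{6+o(1)}+N^{5+o(1)}. $$
   Context: $\mathbb{F}_q$ is the field of $q$ elements, $q$ prime; integers are viewed in $\mathbb{F}_q$ by reduction modulo $q$, so $\{j,2j,\ldots,Nj\}$ is a subset of $\mathbb{F}_q$. For a quantity $V>1$, $V^{o(1)}$ (as $V\to\infty$) denotes a function $U$ of $V$ satisfying $|U|\le V^{\varepsilon}$ for every $\varepsilon>0$, provided $V$ is large enough in terms of $\varepsilon$; thus the bound means that for every $\varepsilon>0$ and all $N$ large enough in terms of $\varepsilon$ the inequality holds with $o(1)$ replaced by $\varepsilon$, uniformly over $q$ and $j$. *)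

(* Defs.v *)
(* Mathematical Components with MathComp-Analysis. *)
From mathcomp Require Import all_boot all_order all_algebra.
From mathcomp Require Import reals exp.

Set Implicit Arguments.
Unset Strict Implicit.
Unset Printing Implicit Defensive.

Import Order.TTheory GRing.Theory Num.Theory.

Local Open Scope ring_scope.

(* The set {j, 2j, ..., Nj}; here m : 'I_N runs over 0, ..., N - 1.
   'F_q is the field of q elements only for q prime. *)
Definition multiples (q N : nat) (j : 'F_q) : {set 'F_q} :=
  [set m.+1%:R * j | m : 'I_N].

(* The tuple (b_1, ..., b_8) is b : {ffun 'I_8 -> 'F_q}, with b_i = b (i - 1). *)
Definition T42 (q N : nat) (j : 'F_q) : nat :=
  #|[set b : {ffun 'I_8 -> 'F_q} |
      (\sum_(i < 8 | (i < 4)%N) b i == \sum_(i < 8 | (4 <= i)%N) b i)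
      && [forall i, b i ^+ 2 \in multiples N j]]|.

(* Main.v *)
(* Let A be the set of b with b^2 in {j, ..., Nj}; it is symmetric and has at
   most 2N elements, and T is the number of zero sums of length 8 in A.  By
   convolution and AM-GM, T <= |A|^(8 - 2k) Z_(2k), where Z_(2k) counts the zero
   sums of length 2k.

   Suppose b_1 + ... + b_l = 0 with b_i^2 = n_i j.  The product of the 2^(l-1)
   forms X_1 +- X_2 +- ... +- X_l is even in each variable, so at b it equals
   j^(2^(l-2)) G(n) with G(n) an integer, while at (sqrt n_i) it equals G(n);
   hence |G(n)| <= (l^2 N)^(2^(l-2)).  If q is larger than this, G(n) = 0 and
   some signed sum of the sqrt n_i vanishes.  A trace argument then shows that
   each n_i has a partner n_i', i' <> i, with n_i n_i' a perfect square, and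
   there are only N^(l/2 + o(1)) such n.

   So Z_2 << N always, Z_4 <= N^(2 + o(1)) if q > (16 N)^4, and
   Z_6 <= N^(3 + o(1)) if q > (36 N)^16.  Using l = 2 for q <= N^14, l = 4 for
   N^14 < q <= (36 N)^16 and l = 6 beyond, T is at most N^14 / q^(1/2) in the
   first two cases and N^5 in the third, up to N^o(1); the term
   N^(5/8) / q^(1/8) is never needed. *)

From HB Require Import structures.
Require Import Defs.
From mathcomp Require Import all_boot all_order all_algebra.
From mathcomp Require Import all_fingroup all_field.
From mathcomp Require Import ring lra zify.
From mathcomp Require Import reals exp.

Set Implicit Arguments.
Unset Strict Implicit.
Unset Printing Implicit Defensive.

Import Order.TTheory GRing.Theory Num.Theory.

Local Open Scope ring_scope.

(** * Numbers of representations as sums *)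

Definition nsums (V : finZmodType) (A : {set V}) (k : nat) (x : V) : nat :=
  #|[set b : {ffun 'I_k -> V} | (\sum_i b i == x) && [forall i, b i \in A]]|.

Lemma forall_split_ord m n (P : pred 'I_(m + n)) :
  [forall i, P i] = [forall i, P (lshift n i)] && [forall i, P (rshift m i)].
Proof.
apply/forallP/andP => [Pi|[/forallP PL /forallP PR] i].
  by split; apply/forallP.
by rewrite -[i]splitK; case: (split i) => j; [apply: PL | apply: PR].
Qed.

Lemma nsumsD (V : finZmodType) (A : {set V}) m n x :
  nsums A (m + n) x = (\sum_y nsums A m y * nsums A n (x - y)%R)%N.
Proof.
rewrite /nsums -sum1dep_card.
rewrite (partition_big (fun b : {ffun 'I_(m + n) -> V} => \sum_i b (lshift n
  i)) xpredT) //=.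
apply: eq_bigr => y _; rewrite -cardsX -sum1_card.
pose glue (p : {ffun 'I_m -> V} * {ffun 'I_n -> V}) : {ffun 'I_(m + n) -> V} :=
  [ffun i => match split i with inl j => p.1 j | inr j => p.2 j end].
have glueL p i : glue p (lshift n i) = p.1 i.
  by rewrite ffunE -[lshift n i]/(unsplit (inl i)) unsplitK.
have glueR p i : glue p (rshift m i) = p.2 i.
  by rewrite ffunE -[rshift m i]/(unsplit (inr i)) unsplitK.
rewrite (reindex glue) /=; last first.
  exists (fun b : {ffun 'I_(m + n) -> V} =>
    ([ffun i => b (lshift n i)], [ffun i => b (rshift m i)])) => [p _|b _].
    by case: p => p1 p2; congr pair; apply/ffunP=> i;
      rewrite ffunE ?glueL ?glueR.
  apply/ffunP=> i; rewrite -[i]splitK.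
  by case: (split i) => j /=; rewrite ?glueL ?glueR ffunE.
apply: eq_bigl => -[p1 p2]; rewrite !inE /= big_split_ord forall_split_ord /=.
rewrite !(eq_bigr _ (fun i _ => glueL _ i)) (eq_bigr _ (fun i _ => glueR _ i))
  /=.
have -> : [forall i, glue (p1, p2) (lshift n i) \in A] = [forall i, p1 i \in A].
  by apply: eq_forallb => i; rewrite glueL.
have -> : [forall i, glue (p1, p2) (rshift m i) \in A] = [forall i, p2 i \in A].
  by apply: eq_forallb => i; rewrite glueR.
case: (eqVneq (\sum_i p1 i) y) => [->|]; last by rewrite andbF.
rewrite andbT /= [_ == x - y]eq_sym subr_eq [x == _]eq_sym [X in X == x]addrC.
by rewrite andbCA.
Qed.

Lemma sum_nsums (V : finZmodType) (A : {set V}) k :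
  (\sum_x nsums A k x = #|A| ^ k)%N.
Proof.
transitivity #|[set b : {ffun 'I_k -> V} | [forall i, b i \in A]]|.
  rewrite -[RHS]sum1dep_card (partition_big (fun b : {ffun 'I_k -> V} => \sum_i
    b i) xpredT) //=.
  by apply: eq_bigr => x _; rewrite /nsums -sum1dep_card; apply: eq_bigl => b;
    rewrite andbC.
rewrite cardsE -[in RHS](card_ord k) -card_ffun_on; apply: eq_card => b.
by rewrite !inE; apply/forallP/ffun_onP.
Qed.

Lemma nsumsN (V : finZmodType) (A : {set V}) k x :
  (forall a, (- a \in A) = (a \in A)) -> nsums A k (- x) = nsums A k x.
Proof.
move=> AN; rewrite /nsums -!sum1dep_card.
pose opp (b : {ffun 'I_k -> V}) : {ffun 'I_k -> V} := [ffun i => - b i].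
have oppK : involutive opp by move=> b; apply/ffunP=> i; rewrite !ffunE opprK.
rewrite (reindex_inj (inv_inj oppK)) /=; apply: eq_bigl => b.
under eq_bigr do rewrite ffunE.
rewrite sumrN eqr_opp; congr andb.
by apply: eq_forallb => i; rewrite ffunE AN.
Qed.

(** By symmetry the count at 0 is the sum of the squares of [nsums A k y]; at x it is the
    correlation of this function with a translate, bounded by AM-GM. *)
Lemma nsums_le0 (V : finZmodType) (A : {set V}) k x :
  (forall a, (- a \in A) = (a \in A)) ->
  (nsums A (k + k) x <= nsums A (k + k) 0%R)%N.
Proof.
move=> AN; rewrite -(leq_pmul2l (isT : 0 < 2)%N) !nsumsD.
have -> : (2 * \sum_y nsums A k y * nsums A k (0 - y)%R =
           \sum_y (nsums A k y ^ 2 + nsums A k (x - y)%R ^ 2))%N.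
  under eq_bigr do rewrite sub0r nsumsN // mulnn.
  rewrite big_split /= mul2n -addnn; congr addn.
  by rewrite (reindex_inj (inv_inj (subKr x))).
by rewrite big_distrr /=; apply: leq_sum => y _; rewrite nat_Cauchy.
Qed.

(** The last m terms are free in A, and the first k + k must then hit a prescribed value, which
    happens most often at 0. *)
Lemma nsums_reduce (V : finZmodType) (A : {set V}) k m x :
  (forall a, (- a \in A) = (a \in A)) ->
  (nsums A (k + k + m) x <= nsums A (k + k) 0%R * #|A| ^ m)%N.
Proof.
move=> AN; rewrite nsumsD -sum_nsums big_distrr /=.
rewrite [leqRHS](reindex_inj (inv_inj (subKr x))) /=.
by apply: leq_sum => y _; rewrite leq_mul2r nsums_le0 ?orbT.
Qed.

(** * Vanishing sums of square roots *)

Definition is_square (n : nat) : bool := [exists a : 'I_n.+1, n == a ^ 2]%N.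

Lemma is_squareP n : reflect (exists a, n = a ^ 2)%N (is_square n).
Proof.
apply: (iffP existsP) => [[a /eqP]|[a na]]; first by exists a.
have a_lt : (a < n.+1)%N by rewrite ltnS na; case: a {na} => // a;
  rewrite leq_pmull.
by exists (Ordinal a_lt); apply/eqP.
Qed.

Lemma rat_sqr_is_square (m : nat) (r : rat) : r ^+ 2 = m%:R -> is_square m.
Proof.
move=> rm; have : numq r ^+ 2 = m%:Z * denq r ^+ 2.
  apply: (intr_inj (R := rat)); rewrite !expr2 !intrM numqE -[m%:~R]rm.
  by rewrite expr2; ring.
move/(congr1 absz); rewrite abszM !abszX /= => num_den.
have : (`|denq r| ^ 2 = 1)%N.
  have /gcdn_idPl <- : (`|denq r| ^ 2 %| `|numq r| ^ 2)%N by rewrite num_den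
    dvdn_mull.
  by apply/eqP; rewrite -[_ == _]/(coprime _ _) coprimeXl // coprimeXr //
    coprime_sym coprime_num_den.
by move=> den1; apply/is_squareP; exists `|numq r|%N;
  rewrite num_den den1 muln1.
Qed.

(** Each automorphism sends z to z or - z. If one gave - z, the trace would equal its own opposite;
    so a nonzero trace makes z fixed, hence rational, hence m a square. *)
Lemma galTrace_sqrt (L : splittingFieldType rat) (m : nat) (z : L) :
  galois 1 {:L} -> z ^+ 2 = m%:R -> ~~ is_square m -> galTrace 1 {:L} z = 0.
Proof.
move=> galL zm; apply: contraNeq => tr_neq0.
have : z \in fixedField 'Gal({:L} / 1)%g.
  apply/fixedFieldP => [|g gG]; first exact: memvf.
  have /eqP : (g z) ^+ 2 = z ^+ 2 by rewrite -rmorphXn zm rmorph_nat.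
  rewrite eqf_sqr => /orP[/eqP //|/eqP gz].
  have := galTrace_gal (memvf z) gG.
  rewrite gz raddfN => /eqP; rewrite eq_sym -addr_eq0 -mulr2n -mulr_natr
    mulf_eq0.
  rewrite (negPf tr_neq0) /= => /eqP two0.
  by have := pchar_lalg L 2; rewrite pchar_num inE /= two0 eqxx.
move/galois_fixedField: galL => -> /vlineP[r zr].
apply: (@rat_sqr_is_square _ r); apply: (fmorph_inj (in_alg L)).
by rewrite rmorph_nat rmorphXn -zm zr.
Qed.

(** The trace needs a Galois number field: the x i generate a splitting field of the product of the
    X ^ 2 - n i. *)
Lemma sqrt_splittingField (I : finType) (n : I -> nat) (x : I -> algC) :
  (forall i, x i ^+ 2 = (n i)%:R) ->
  exists (L : splittingFieldType rat) (LC : {rmorphism L -> algC}) (y : I -> L),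
    galois 1 {:L} /\ forall i, LC (y i) = x i.
Proof.
move=> x2; pose xs := [seq x i | i : I].
have [L [LC [ys ysx genL]]] := num_field_exists xs.
have yP i : {y | LC y = x i & y \in ys}.
  have : x i \in map LC ys by rewrite ysx; apply/imageP; exists i.
  by case/mapP/sig2_eqW => y ys_y ->; exists y.
pose y i := s2val (yP i).
have yx i : LC (y i) = x i by exact: (s2valP (yP i)).
have y2 i : y i ^+ 2 = (n i)%:R by apply: (fmorph_inj LC);
  rewrite rmorphXn rmorph_nat /= yx.
have splitL : SplittingField.axiom L.
  exists (\prod_i ('X^2 - (n i)%:R%:P)).
    by apply: rpred_prod => i _;
      rewrite rpredB ?rpredX ?polyOverX ?polyOverC ?rpred_nat.
  exists (flatten [seq [:: y i; - y i] | i : I]).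
    rewrite big_flatten big_map /= big_enum /=.
    rewrite (eq_bigr (fun i => \prod_(z <- [:: y i;
      - y i]) ('X - z%:P))) ?eqpxx //.
    move=> i _; rewrite big_cons big_seq1 -y2 rmorphXn polyCN opprK.
    by rewrite subr_sqr.
  apply/eqP; rewrite eqEsubv subvf -genL adjoin_seqSr // => z ys_z.
  have /imageP[i _ zi] : LC z \in xs by rewrite -ysx map_f.
  have -> : z = y i by apply: (fmorph_inj LC); rewrite yx.
  by apply/flattenP; exists [:: y i; - y i]; rewrite ?mem_head //;
    apply/imageP; exists i.
pose splitM := FieldExt_isSplittingField.Build rat L splitL.
pose L' : splittingFieldType rat := HB.pack L splitM.
exists L', LC, y; split=> //.
apply/and3P; split; first exact: sub1v.
  by apply/separableP => u _; apply: pcharf0_separable => p;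
    rewrite pchar_lalg pchar_num.
exact: normalFieldf.
Qed.

(* If no other term had n i * n i0 a square, multiplying the relation by
   sqrt (n i0) and taking the trace would leave only c i0 * n i0. *)
Lemma sum_sqrt_partner (I : finType) (n : I -> nat) (c : I -> int)
    (x : I -> algC) (i0 : I) :
  (forall i, x i ^+ 2 = (n i)%:R) -> \sum_i (c i)%:~R * x i = 0 ->
  c i0 != 0 -> (0 < n i0)%N -> exists2 i, i != i0 & is_square (n i * n i0).
Proof.
move=> x2 sum0 c0 n0; apply/exists_inP/contraT; rewrite negb_exists_in.
move=> /forall_inP/= nsq.
have [L [LC [y [galL yx]]]] := sqrt_splittingField x2.
have y2 i : y i ^+ 2 = (n i)%:R.
  by apply: (fmorph_inj LC); rewrite rmorphXn rmorph_nat /= yx.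
have sumL : \sum_i (c i)%:~R * (y i * y i0) = 0.
  apply: (fmorph_inj LC); rewrite rmorph0 -[RHS](mul0r (x i0)) -sum0 mulr_suml
    rmorph_sum /=.
  by apply: eq_bigr => i _; rewrite !rmorphM rmorph_int /= !yx mulrA.
have := congr1 (galTrace 1 {:L}) sumL.
rewrite raddf0 raddf_sum (bigD1 i0) //= big1 ?addr0 => [|i ii0]; last first.
  rewrite mulrzl raddfMz /= (@galTrace_sqrt L (n i * n i0)) ?mul0rz ?nsq //.
  by rewrite exprMn !y2 -natrM.
(* Only i0 is left, and the trace of [n i0] is [n i0] times the order of the Galois group. *)
rewrite mulrzl -expr2 y2 raddfMz /= /galTrace.
under eq_bigr do rewrite rmorph_nat.
rewrite sumr_const => /(congr1 LC)/eqP.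
rewrite rmorph0 rmorphMz rmorphMn rmorph_nat mulrz_eq0 (negPf c0) /= mulrn_eq0.
by rewrite (eqn0Ngt #|_|) cardG_gt0 pnatr_eq0 eqn0Ngt n0.
Qed.

(** * The product of all signed sums *)

(* The sign of the variable of index 0 is always +. *)
Definition sgn_at k (e : {ffun 'I_k -> bool}) (i : 'I_k.+1) : bool :=
  if unlift ord0 i is Some t then e t else false.

Definition signprod (S : comNzRingType) k (X : 'I_k.+1 -> S) : S :=
  \prod_(e : {ffun 'I_k -> bool}) \sum_i (-1) ^+ sgn_at e i * X i.

(** [f] chooses one term in each factor of [signprod]; this is the degree of the i-th variable in
    the monomial so obtained. *)
Definition exponent k (f : {ffun {ffun 'I_k -> bool} -> 'I_k.+1}) (i : 'I_k.+1)
  : nat :=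
  #|[pred e | f e == i]|.

Definition sign_coef (S : comNzRingType) k (f : {ffun {ffun 'I_k -> bool} ->
  'I_k.+1}) : S :=
  \prod_e (-1) ^+ sgn_at e (f e).

Lemma signprodE (S : comNzRingType) k (X : 'I_k.+1 -> S) :
  signprod X = \sum_f sign_coef S f * \prod_i X i ^+ exponent f i.
Proof.
rewrite /signprod bigA_distr_bigA; apply: eq_bigr => f _.
rewrite big_split; congr (_ * _) => /=.
rewrite (partition_big f xpredT) //=; apply: eq_bigr => i _.
by rewrite -prodr_const; apply: eq_big => [e|e /eqP->].
Qed.

(** Changing signs of variables permutes the factors: [e] becomes its exclusive or with [d]. *)
Lemma signprod_flip (S : comNzRingType) k (X : 'I_k.+1 -> S) (d : {ffun 'I_k ->
  bool}) :
  signprod (fun i => (-1) ^+ sgn_at d i * X i) = signprod X.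
Proof.
pose tr (e : {ffun 'I_k -> bool}) : {ffun 'I_k -> bool} := [ffun t => e t (+) d
  t].
have trK : involutive tr by move=> e; apply/ffunP=> t; rewrite !ffunE addbK.
rewrite [RHS]/signprod (reindex_inj (inv_inj trK)) /=.
apply: eq_bigr => e _; apply: eq_bigr => i _; rewrite mulrA; congr (_ * _).
rewrite /sgn_at; case: unliftP => [t|] _; last by rewrite mulr1.
by rewrite ffunE signr_addb.
Qed.

Lemma sum_sgn_at (S : comNzRingType) k (m : 'I_k.+1 -> nat) :
  \sum_(d : {ffun 'I_k -> bool}) \prod_i ((-1) ^+ sgn_at d i) ^+ m i =
  if [forall t, ~~ odd (m (lift ord0 t))] then 2 ^+ k else 0 :> S.
Proof.
transitivity (\prod_(t < k) \sum_(b : bool) ((-1) ^+ b) ^+ m (lift ord0 t) : S).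
  rewrite bigA_distr_bigA; apply: eq_bigr => d _.
  rewrite big_ord_recl /sgn_at unlift_none expr1n mul1r.
  by apply: eq_bigr => t _; rewrite liftK.
under eq_bigr do rewrite big_bool /= expr1n expr1 -signr_odd.
case: ifPn => [/forallP ev|].
  rewrite -[in RHS](card_ord k) -prodr_const; apply: eq_bigr => t _.
  by rewrite (negPf (ev t)).
rewrite negb_forall => /existsP[t]; rewrite negbK => od.
by rewrite (bigD1 t) //= od expr1 addNr mul0r.
Qed.

Lemma sum_exponent k (f : {ffun {ffun 'I_k -> bool} -> 'I_k.+1}) :
  (\sum_i exponent f i = 2 ^ k)%N.
Proof.
transitivity #|{ffun 'I_k -> bool}|;
  last by rewrite card_ffun card_bool card_ord.
rewrite -sum1_card (partition_big f xpredT) //=; apply: eq_bigr => i _.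
by rewrite -[LHS]sum1_card.
Qed.

(** Averaging over all sign changes fixes the product and kills every monomial with an odd exponent
    away from index 0. *)
Lemma signprod_even (S : idomainType) k (X : 'I_k.+2 -> S) : 2 != 0 :> S ->
  signprod X = \sum_(f | [forall i, ~~ odd (exponent f i)]) sign_coef S f *
    \prod_i X i ^+ exponent f i.
Proof.
move=> two0; apply: (mulfI (expf_neq0 k.+1 two0)).
transitivity (\sum_(d : {ffun 'I_k.+1 -> bool}) signprod (fun i => (-1) ^+
  sgn_at d i * X i)).
  under eq_bigr do rewrite signprod_flip.
  by rewrite sumr_const card_ffun card_bool card_ord -[RHS]mulr_natl natrX.
under eq_bigr do rewrite signprodE.
rewrite exchange_big /= [in RHS]big_distrr [in RHS]big_mkcond /=;
  apply: eq_bigr => f _.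
under eq_bigr => d _ do under eq_bigr => i _ do rewrite exprMn.
under eq_bigr => d _ do rewrite big_split /= mulrCA mulrC.
rewrite -big_distrr /= sum_sgn_at.
have -> : [forall i, ~~ odd (exponent f i)] = [forall t, ~~ odd (exponent f
  (lift ord0 t))].
  apply/forallP/forallP => [ev t|ev i]; first exact: ev.
  case: (unliftP ord0 i) => [t ->//|->].
  (* Index 0 carries no sign: its exponent is even because the total degree 2 ^ k.+1 is. *)
  have := congr1 odd (sum_exponent f); rewrite big_ord_recl oddD oddX /=.
  rewrite (big_morph odd oddD (erefl : odd 0 = false)) big1 ?addbF => [->//|t
    _].
  by apply: negbTE; apply: ev.
by case: ifP => _; rewrite ?mulr0 // mulrC.
Qed.

(** This is the G(n) of the outline: the even monomials, with [n i] for the square of the i-th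
    variable. Being an integer, it can be read both in ['F_q] and in [algC]. *)
Definition signpol k (n : 'I_k.+2 -> nat) : int :=
  \sum_(f : {ffun {ffun 'I_k.+1 -> bool} -> 'I_k.+2} | [forall i, ~~ odd
    (exponent f i)])
    sign_coef int f * \prod_i (n i)%:R ^+ (exponent f i)./2.

(** The power of j is half of the degree 2 ^ k.+1. The ring stays general to cover ['F_q] and, with
    j = 1, [algC]. *)
Lemma signprod_sqr (S : idomainType) k (X : 'I_k.+2 -> S) (n : 'I_k.+2 -> nat)
  (j : S) :
  2 != 0 :> S -> (forall i, X i ^+ 2 = (n i)%:R * j) ->
  signprod X = (signpol n)%:~R * j ^+ (2 ^ k).
Proof.
move=> two0 X2; rewrite signprod_even // /signpol rmorph_sum /= mulr_suml.
apply: eq_bigr => f /forallP ev; rewrite rmorphM /= -mulrA; congr (_ * _).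
  by rewrite rmorph_prod; apply: eq_bigr => e _; rewrite rmorph_sign.
have half i : (exponent f i = (exponent f i)./2 * 2)%N by rewrite muln2
  even_halfK.
transitivity (\prod_i ((n i)%:R ^+ (exponent f i)./2 * j ^+ (exponent f i)./2)).
  by apply: eq_bigr => i _; rewrite [in LHS]half mulnC exprM X2 exprMn.
rewrite big_split /= prodrXr rmorph_prod; congr (_ * j ^+ _).
  by apply: eq_bigr => i _; rewrite rmorphXn /= rmorph_nat.
apply/eqP; rewrite -(eqn_pmul2r (isT : 0 < 2)%N) -expnSr -(sum_exponent f)
  big_distrl /=.
by apply/eqP/eq_bigr => i _; rewrite -half.
Qed.

(** * Counting tuples in which every entry has a partner *)

(** Squares replace a square root of Q: once both sides are expanded, [B i * B j] is at most Q
    because its square is at most Q ^ 2. *)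
Lemma leq_sum_sqr (I : finType) (P : pred I) (B C : I -> nat) (Q : nat) :
  (forall i, P i -> B i ^ 2 <= Q)%N ->
  ((\sum_(i | P i) C i * B i) ^ 2 <= (\sum_(i | P i) C i) ^ 2 * Q)%N.
Proof.
move=> BQ; rewrite -!mulnn !big_distrlr big_distrl /=; apply: leq_sum => i Pi.
rewrite big_distrl; apply: leq_sum => j Pj;
  rewrite mulnACA leq_mul2l -leq_sqr expnMn.
by rewrite -[(Q ^ 2)%N]mulnn leq_mul ?BQ // orbT.
Qed.

(** Split [c y ^ 2] off each term; the square of the rest is [(c y ^ 2) ^ (s - 2)], at most the same
    power of the whole sum. *)
Lemma leq_sum_exp_sqr (Y : finType) (c : Y -> nat) (s : nat) : (1 < s)%N ->
  ((\sum_y c y ^ s) ^ 2 <= (\sum_y c y ^ 2) ^ s)%N.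
Proof.
case: s => [|[|s]] // _; rewrite -addn2 addnC expnD.
under eq_bigr do rewrite expnD.
apply: leq_sum_sqr => y _; rewrite -expnM mulnC expnM.
case: s => // s; rewrite leq_exp2r //.
by rewrite (bigD1 y) //= leq_addr.
Qed.

Lemma card_familyE (I X : finType) (F : I -> pred X) :
  #|family F| = (\prod_i #|F i|)%N.
Proof. by rewrite card_family foldrE big_map big_enum. Qed.

Lemma leq_card_bigcup (I X : finType) (P : pred I) (A : I -> {set X}) :
  (#|\bigcup_(i | P i) A i| <= \sum_(i | P i) #|A i|)%N.
Proof.
elim/big_rec2: _ => [|i B m _ le]; first by rewrite cards0.
by rewrite (leq_trans (leq_card_setU _ _)) // leq_add2l.
Qed.

Definition partnered (I X Y : finType) (d : X -> Y) : {set {ffun I -> X}} :=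
  [set x : {ffun I -> X} | [forall i, [exists i', (i' != i) && (d (x i') == d
    (x i))]]].

(* If every class meets the tuple at least twice, then the l^s norm, s >= 2, of
   the class sizes is at most their l^2 norm. *)
Lemma card_partnered (I X Y : finType) (d : X -> Y) (y0 : Y) :
  (#|partnered I d| ^ 2 <=
   (#|I| ^ #|I|) ^ 2 * #|[set p : X * X | d p.1 == d p.2]| ^ #|I|)%N.
Proof.
pose c y := #|[pred x | d x == y]|.
have -> : #|[set p : X * X | d p.1 == d p.2]| = (\sum_y c y ^ 2)%N.
  rewrite -sum1dep_card (partition_big (fun p => d p.2) xpredT) //=.
  apply: eq_bigr => y _; rewrite -mulnn -cardX -sum1_card;
    apply: eq_bigl => -[x1 x2].
  by rewrite !inE /=; case: (eqVneq (d x2) y) => [->|]; rewrite ?andbF.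
set S := (\sum_y _)%N.
(* A map [l] to representatives encodes a partition of the indices, [s l r] is the size of the block
   of r, and [z] gives the class of each block. [B l] is the number of tuples on whose blocks [d] is
   constant. *)
pose s (l : {ffun I -> I}) r := #|[pred i | l i == r]|.
pose good (l : {ffun I -> I}) := [forall r in codom l, (1 < s l r)%N].
pose B (l : {ffun I -> I}) := (\prod_(r in codom l) \sum_y c y ^ s l r)%N.
pose cell (l : {ffun I -> I}) (z : {ffun I -> Y}) : {set {ffun I -> X}} :=
  [set x in family (fun i => [pred x | d x == z (l i)])].
have cover : partnered I d \subset \bigcup_(l | good l)
    \bigcup_(z in pffun_on y0 (mem (codom l)) predT) cell l z.
  apply/subsetP => x; rewrite inE => /forallP xP.
  (* [pick] depends only on the predicate, so indices of one class get the same representative. *)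
  pose l := [ffun i => odflt i [pick i' | d (x i') == d (x i)]].
  have dl i : d (x (l i)) = d (x i).
    by rewrite ffunE; case: pickP => [i' /eqP//|].
  have l_d i i' : d (x i) = d (x i') -> l i = l i'.
    move=> dii'; rewrite !ffunE (eq_pick (Q := fun k => d (x k) == d (x i'))).
      by case: pickP => // /(_ i'); rewrite eqxx.
    by move=> k /=; rewrite dii'.
  apply/bigcupP; exists l.
    apply/forall_inP => _ /codomP[i ->].
    have /existsP[i' /andP[i'i /eqP dii']] := xP i.
    rewrite /s (cardD1 i) (cardD1 i') !inE eqxx i'i (l_d _ _ dii') eqxx.
    by rewrite addnA.
  (* The value [y0] off the codomain of [l] makes this one of the functions [z] of the union. *)
  apply/bigcupP; exists [ffun r => if r \in codom l then d (x r) else y0].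
    apply/pffun_onP; split => //.
      by apply/supportP => r /negPf rl; rewrite ffunE rl.
  rewrite inE; apply/familyP => i; rewrite inE ffunE codom_f.
  by rewrite dl.
have cardB (l : {ffun I -> I}) : (\sum_(z in pffun_on y0 (mem (codom l)) predT)
  #|cell l z| = B l)%N.
  rewrite /B (big_distr_big y0); apply: eq_bigr => z _.
  rewrite cardsE card_familyE (partition_big l (mem (codom l))) /= => [|i _];
    last exact: codom_f.
  apply: eq_bigr => r _; rewrite -prod_nat_const.
  by apply: eq_big => [i|i /eqP->].
(* The norm inequalities of the blocks multiply to the exponent [#|I|], the total of the block
   sizes. *)
have B2 (l : {ffun I -> I}) : good l -> (B l ^ 2 <= S ^ #|I|)%N.
  move=> /forall_inP gl; rewrite /B (big_morph (expn^~ 2) (fun a b => expnMn a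
    b 2) (exp1n 2)).
  have -> : #|I| = (\sum_(r in codom l) s l r)%N.
    rewrite -sum1_card (partition_big l (mem (codom l))) /= => [|i _];
      last exact: codom_f.
    by apply: eq_bigr => r _; rewrite -[RHS]sum1_card.
  rewrite expn_sum; apply: leq_prod => r rl.
  exact/leq_sum_exp_sqr/gl.
have le_sum : (#|partnered I d| <= \sum_(l | good l) 1 * B l)%N.
  apply: leq_trans (subset_leq_card cover) (leq_trans (leq_card_bigcup _ _) _).
  apply: leq_sum => l _; rewrite mul1n -cardB; exact: leq_card_bigcup.
apply: (@leq_trans ((\sum_(l | good l) 1 * B l) ^ 2)); first by rewrite leq_sqr.
apply: leq_trans (leq_sum_sqr (fun=> 1%N) B2) _.
by rewrite leq_mul2r leq_sqr sum1_card -card_ffun max_card orbT.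
Qed.

(** * Pairs of integers whose product is a square *)

Lemma is_square_trans a b c : (0 < b)%N ->
  is_square (a * b) -> is_square (b * c) -> is_square (a * c).
Proof.
move=> b0 /is_squareP[u ab] /is_squareP[v bc]; apply/is_squareP.
have E : (a * c * b ^ 2 = (u * v) ^ 2)%N by rewrite expnMn -ab -bc; lia.
have /dvdnP[w uvw] : (b %| u * v)%N by rewrite -(@dvdn_pexp2r _ _ 2) // -E
  dvdn_mull.
exists w; apply/eqP; rewrite -(eqn_pmul2r (_ : 0 < b ^ 2)%N) ?expn_gt0 ?b0 //.
by rewrite E uvw expnMn.
Qed.

(** Let ab = c ^ 2 and h = gcd (a, c), with a = sh and c = th. Then sb = ht ^ 2, and s, coprime to
    t, divides h; g is the quotient. *)
Lemma is_square_mul_gcd a b : (0 < a)%N -> is_square (a * b) ->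
  exists g s t, a = (g * s ^ 2)%N /\ b = (g * t ^ 2)%N.
Proof.
move=> a0 /is_squareP[c ab]; pose h := gcdn a c.
have h0 : (0 < h)%N by rewrite gcdn_gt0 a0.
have ah : (a = a %/ h * h)%N by rewrite divnK ?dvdn_gcdl.
have ch : (c = c %/ h * h)%N by rewrite divnK ?dvdn_gcdr.
set s := (a %/ h)%N in ah; set t := (c %/ h)%N in ch.
have co : coprime s t by rewrite /coprime -(eqn_pmul2r h0) mul1n muln_gcdl -ah
  -ch.
have E : (s * b = h * t ^ 2)%N.
  apply/eqP; rewrite -(eqn_pmul2r h0); apply/eqP.
  have -> : (s * b * h = a * b)%N by rewrite [in RHS]ah; lia.
  by rewrite ab ch expnMn; lia.
have /dvdnP[g hg] : (s %| h)%N.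
  by rewrite -(@Gauss_dvdl _ _ (t ^ 2)) ?coprimeXr // -E dvdn_mulr.
have s0 : (0 < s)%N by move: a0; rewrite {1}ah muln_gt0 => /andP[].
exists g, s, t; split; first by rewrite ah hg; lia.
by apply/eqP; rewrite -(eqn_pmul2l s0) E hg; apply/eqP; lia.
Qed.

Lemma card_ord_leq N M (A : {set 'I_N}) :
  (forall i, i \in A -> (i < M)%N) -> (#|A| <= M)%N.
Proof.
move=> ltM; rewrite cardE -(size_map val) -[leqRHS](size_iota 0).
apply: uniq_leq_size; first by rewrite (map_inj_uniq val_inj) enum_uniq.
by move=> x /mapP[i + ->]; rewrite mem_enum mem_iota => /ltM.
Qed.

(** If m is the largest member, the count is at most [m.+1], whose square is at most [N %/ g.+1]. *)
Lemma card_scaled_squares N g :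
  (#|[set s : 'I_N | g.+1 * s.+1 ^ 2 <= N]| ^ 2 <= N %/ g.+1)%N.
Proof.
set A := [set _ | _]; have [->|[s0 s0A]] := set_0Vmem A;
  first by rewrite cards0.
have [m mA mmax] := arg_maxnP (fun s : 'I_N => s : nat) s0A.
have cardA : (#|A| <= m.+1)%N by apply: card_ord_leq => i /mmax; rewrite ltnS.
have : m \in A by [].
rewrite leq_divRL // mulnC inE; apply: leq_trans.
by rewrite leq_mul2l leq_exp2r // cardA.
Qed.

(** Such a pair is g (s ^ 2, t ^ 2) with g at most N, and s and t each take at most sqrt (N / g)
    values. *)
Lemma card_square_pairs N :
  (#|[set p : 'I_N * 'I_N | is_square (p.1.+1 * p.2.+1)]| <= \sum_(g < N) N %/
    g.+1)%N.
Proof.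
pose A g := [set s : 'I_N | g.+1 * s.+1 ^ 2 <= N]%N.
pose cell (g : 'I_N) := [set p : 'I_N * 'I_N |
  [exists st : 'I_N * 'I_N, [&& st.1 \in A g, st.2 \in A g,
     p.1.+1 == g.+1 * st.1.+1 ^ 2 & p.2.+1 == g.+1 * st.2.+1 ^ 2]]]%N.
apply: (@leq_trans #|\bigcup_g cell g|).
  apply/subset_leq_card/subsetP => -[a b];
    rewrite inE /= => /is_square_mul_gcd[//|g [s [t [ag bg]]]].
  have ltN (x : 'I_N) : (x.+1 <= N)%N by [].
  have : (0 < g * s ^ 2)%N by rewrite -ag.
  have : (0 < g * t ^ 2)%N by rewrite -bg.
  rewrite !muln_gt0 => /and3P[g0 t0 _] /and3P[_ s0 _].
  have le_mul x y : (0 < x)%N -> (0 < y)%N -> (x <= x * y ^ 2)%N /\ (y <= x * y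
    ^ 2)%N.
    by move=> x0 y0; split; [rewrite leq_pmulr ?expn_gt0 ?y0 | nia].
  have [gA sA] := le_mul g s g0 s0; have [_ tB] := le_mul g t g0 t0.
  rewrite -ag -bg in gA sA tB.
  have gN : (g.-1 < N)%N by rewrite prednK // (leq_trans gA).
  have sN : (s.-1 < N)%N by rewrite prednK // (leq_trans sA).
  have tN : (t.-1 < N)%N by rewrite prednK // (leq_trans tB).
  apply/bigcupP; exists (Ordinal gN) => //; rewrite inE; apply/existsP.
  exists (Ordinal sN, Ordinal tN); rewrite !inE /= !prednK //.
  by rewrite ag bg !eqxx -ag -bg !ltN.
apply: leq_trans (leq_card_bigcup _ _) _; apply: leq_sum => g _.
apply: leq_trans (card_scaled_squares N g); rewrite -mulnn -cardsX.
pose val_pair (p : 'I_N * 'I_N) := (p.1.+1, p.2.+1).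
have val_inj : injective val_pair by move=> [? ?] [? ?] [/ord_inj-> /ord_inj->].
rewrite !cardE -(size_map val_pair).
rewrite -[leqRHS](size_map (fun st : 'I_N * 'I_N => (g.+1 * st.1.+1 ^ 2, g.+1 *
  st.2.+1 ^ 2))%N).
apply: uniq_leq_size; first by rewrite (map_inj_uniq val_inj) enum_uniq.
move=> x /mapP[p + ->]; rewrite mem_enum inE => /existsP[[s t] /and4P[s_A t_A
  /eqP p1 /eqP p2]].
apply/mapP; exists (s, t); last by rewrite /val_pair p1 p2.
by rewrite mem_enum in_setX; apply/andP.
Qed.

(** * Zero sums of modular square roots *)

Lemma signprod_sqrtC k (n : 'I_k.+2 -> nat) :
  signprod (fun i => sqrtC (n i)%:R) = (signpol n)%:~R :> algC.
Proof.
rewrite (signprod_sqr (n := n) (j := 1)) ?expr1n ?mulr1 ?pnatr_eq0 // => i.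
by rewrite sqrtCK mulr1.
Qed.

(** At the square roots in [algC] there are 2 ^ k.+1 factors, each of modulus at most k.+2 times
    sqrt N. *)
Lemma signpol_le k (n : 'I_k.+2 -> nat) N : (forall i, (n i <= N)%N) ->
  (`|signpol n| <= (k.+2 ^ 2 * N) ^ (2 ^ k))%N.
Proof.
move=> nN; rewrite -(ler_nat algC) natr_absz intr_norm -signprod_sqrtC.
rewrite /signprod normr_prod.
apply: (@le_trans _ _ (\prod_(e : {ffun 'I_k.+1 -> bool}) (k.+2%:R * sqrtC
  N%:R))).
  apply: ler_prod => e _; rewrite normr_ge0 /= (le_trans (ler_norm_sum _ _ _))
    //.
  rewrite -[X in X%:R * _](card_ord k.+2) mulr_natl -sumr_const;
    apply: ler_sum => i _.
  rewrite normrM normr_sign mul1r ger0_norm ?sqrtC_ge0 ?ler0n //.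
  by rewrite ler_sqrtC ?ler_nat // qualifE /= ler0n.
rewrite prodr_const card_ffun card_bool card_ord (expnS 2 k) exprM.
by rewrite [(_ * _) ^+ 2]exprMn sqrtCK natrX natrM natrX.
Qed.

Lemma signpol_eq0_partner k (n : 'I_k.+2 -> nat) (i0 : 'I_k.+2) :
  signpol n = 0 -> (0 < n i0)%N -> exists2 i, i != i0 & is_square (n i * n i0).
Proof.
move=> n0 ni0; have /eqP := signprod_sqrtC n; rewrite n0 prodf_seq_eq0.
case/hasP => e _ /eqP sum0.
apply: (sum_sqrt_partner (x := fun i => sqrtC (n i)%:R)
          (c := fun i => (-1) ^+ sgn_at e i)) ni0 => [i||].
- by rewrite sqrtCK.
- by apply: etrans sum0; apply: eq_bigr => i _; rewrite rmorph_sign.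
- by rewrite signr_eq0.
Qed.

Lemma card_sqrts (F : finIdomainType) (c : F) : (#|[pred x | x ^+ 2 == c]| <=
  2)%N.
Proof.
have [x0 /eqP x0c|no] := pickP (fun x => x ^+ 2 == c); last by rewrite eq_card0.
apply: (@leq_trans #|[set x0; - x0]|); last by rewrite cards2; case: (_ != _).
by apply/subset_leq_card/subsetP => x; rewrite !inE -x0c eqf_sqr.
Qed.

Definition roots_of_multiples (q N : nat) (j : 'F_q) : {set 'F_q} :=
  [set b | b ^+ 2 \in multiples N j].

Lemma roots_of_multiplesP q N (j b : 'F_q) :
  reflect (exists m : 'I_N, b ^+ 2 = m.+1%:R * j) (b \in roots_of_multiples N
    j).
Proof.
by rewrite inE; apply: (iffP imsetP) => [[m _ bm]|[m bm]]; exists m.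
Qed.

Lemma roots_of_multiplesN q N (j b : 'F_q) :
  (- b \in roots_of_multiples N j) = (b \in roots_of_multiples N j).
Proof. by rewrite !inE sqrrN. Qed.

Lemma card_roots_of_multiples q N (j : 'F_q) : (#|roots_of_multiples N j| <= 2
  * N)%N.
Proof.
apply: (@leq_trans #|\bigcup_(m < N) [set b : 'F_q | b ^+ 2 == m.+1%:R * j]|).
  apply/subset_leq_card/subsetP => b /roots_of_multiplesP[m bm].
  by apply/bigcupP; exists m; rewrite // inE bm.
apply: leq_trans (leq_card_bigcup _ _) _.
rewrite mulnC -[N in leqRHS]card_ord -sum_nat_const; apply: leq_sum => m _.
by rewrite cardsE card_sqrts.
Qed.

Lemma T42_nsums q N (j : 'F_q) : (T42 N j <= nsums (roots_of_multiples N j) 8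
  0%R)%N.
Proof.
pose flip (b : {ffun 'I_8 -> 'F_q}) : {ffun 'I_8 -> 'F_q} :=
  [ffun i : 'I_8 => if (i < 4)%N then b i else - b i].
have flipK : involutive flip.
  by move=> b; apply/ffunP=> i; rewrite !ffunE; case: (i < 4)%N; rewrite ?opprK.
rewrite /T42 -(card_imset _ (inv_inj flipK)).
apply/subset_leq_card/subsetP => _ /imsetP[b + ->];
  rewrite !inE => /andP[/eqP sumb /forallP bA].
apply/andP; split; last first.
  by apply/forallP => i; rewrite ffunE inE; case: ifP => _; rewrite ?sqrrN bA.
rewrite (bigID (fun i : 'I_8 => (i < 4)%N)) /=.
rewrite (eq_bigr b) => [|i i4]; last by rewrite ffunE i4.
rewrite [X in _ + X](eq_bigr (fun i => - b i)) => [|i i4];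
  last by rewrite ffunE (negPf i4).
rewrite sumb sumrN subr_eq0; apply/eqP.
by apply: eq_bigl => i; rewrite leqNgt.
Qed.

Definition square_pairs (N : nat) : nat :=
  #|[set p : 'I_N * 'I_N | is_square (p.1.+1 * p.2.+1)]|.

(** This treats zero sums of length l = k + 2. In the constant, 2 accounts for the at most two roots
    of each n_i j and [k.+2] for the partitions of the indices. *)
Lemma nsums_roots_le q N (j : 'F_q) k : prime q -> odd q -> j != 0 ->
  ((k.+2 ^ 2 * N) ^ (2 ^ k) < q)%N ->
  (nsums (roots_of_multiples N j) k.+2 0%R ^ 2 <=
    ((2 * k.+2) ^ k.+2) ^ 2 * square_pairs N ^ k.+2)%N.
Proof.
move=> q_pr q_odd j0 lt_q.
have two0 : 2 != 0 :> 'F_q.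
  by rewrite -(dvdn_pcharf (pchar_Fp q_pr)) gtnNdvd // (odd_prime_gt2 q_odd).
(* A square class is encoded as a set, so that lying in the same class is an equality, as
   [partnered] expects. *)
pose d (m : 'I_N) := [set m' : 'I_N | is_square (m.+1 * m'.+1)].
have dE (m m' : 'I_N) : (d m == d m') = is_square (m.+1 * m'.+1).
  apply/eqP/idP => [dd|sq].
    have : m' \in d m by rewrite dd inE; apply/is_squareP; exists m'.+1.
    by rewrite inE.
  apply/setP => m2; rewrite !inE; apply/idP/idP; apply: is_square_trans => //.
  by rewrite mulnC.
have cover : [set b : {ffun 'I_k.+2 -> 'F_q} | (\sum_i b i == 0) &&
      [forall i, b i \in roots_of_multiples N j]] \subset
    \bigcup_(m in partnered 'I_k.+2 d)
      [set b in family (fun i => [pred x : 'F_q | x ^+ 2 == (m i).+1%:R * j])].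
  apply/subsetP => b; rewrite inE => /andP[/eqP sumb /forallP bA].
  have bA' i : {m : 'I_N | b i ^+ 2 == m.+1%:R * j}.
    by apply: sigW; have /roots_of_multiplesP[m ->] := bA i; exists m.
  pose m : {ffun 'I_k.+2 -> 'I_N} := [ffun i => sval (bA' i)].
  have bm i : b i ^+ 2 = (m i).+1%:R * j by rewrite ffunE;
    apply/eqP/(svalP (bA' i)).
  apply/bigcupP; exists m; last by rewrite inE; apply/familyP => i;
    rewrite inE bm.
  have pol0 : signpol (fun i => (m i).+1) = 0.
    (* A nonzero G(n) divisible by q would be at least q in absolute value. *)
    apply/eqP; rewrite -absz_eq0; apply/negbNE/negP; rewrite -lt0n => pos.
    have := signpol_le (n := fun i => (m i).+1) (fun i => ltn_ord (m i)).
    apply/negP; rewrite -ltnNge (leq_trans lt_q) // dvdn_leq //.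
    rewrite -[(_ %| _)%N]/((q%:Z %| signpol (fun i => (m i).+1))%Z)
      (dvdz_pcharf (pchar_Fp q_pr)).
    (* The factor with all signs + is the vanishing sum itself. *)
    have := signprod_sqr two0 bm; rewrite /signprod (bigD1 [ffun=> false]) //=.
    rewrite [X in X * _ = _](eq_bigr b) => [|i _]; last first.
      by rewrite /sgn_at; case: unliftP => *; rewrite ?ffunE mul1r.
    by rewrite sumb mul0r => /esym/eqP;
      rewrite mulf_eq0 expf_eq0 (negPf j0) andbF orbF.
  rewrite inE; apply/forallP => i.
  have [i' i'i sq] := signpol_eq0_partner pol0 (ltn0Sn (m i)).
  by apply/existsP; exists i'; rewrite i'i dE.
rewrite /nsums; apply: (@leq_trans ((#|partnered 'I_k.+2 d| * 2 ^ k.+2) ^ 2)).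
  rewrite leq_sqr (leq_trans (subset_leq_card cover)) //.
  rewrite (leq_trans (leq_card_bigcup _ _)) // -sum_nat_const;
    apply: leq_sum => m _.
  rewrite cardsE card_familyE -[X in (2 ^ X)%N](card_ord k.+2) -prod_nat_const.
  by apply: leq_prod => i _; apply: card_sqrts.
have := card_partnered 'I_k.+2 d set0; rewrite card_ord.
have -> : #|[set p : 'I_N * 'I_N | d p.1 == d p.2]| = square_pairs N.
  by apply: eq_card => p; rewrite !inE dE.
rewrite (expnMn 2 k.+2 k.+2).
move: (2 ^ k.+2)%N (k.+2 ^ k.+2)%N (square_pairs N ^ k.+2)%N => a w S le.
by rewrite mulnC !expnMn -mulnA leq_mul2l le orbT.
Qed.

Lemma nsums2_le (V : finZmodType) (A : {set V}) x : (nsums A 2 x <= #|A|)%N.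
Proof.
rewrite -[2%N]/(1 + 1)%N nsumsD -[#|A|]expn1 -sum_nsums; apply: leq_sum => y _.
rewrite -[leqRHS]muln1 leq_mul2l; apply/orP; right.
apply/card_le1P => b; rewrite inE big_ord1 => /andP[/eqP bx bA] b'.
rewrite inE big_ord1 -bx; apply/andP/eqP => [[/eqP bb' _]|->].
  by apply/ffunP => i; rewrite ord1.
by split.
Qed.

(** * Bounds on [T42], one for each range of q *)

Lemma T42_le q N (j : 'F_q) k m : (0 < m)%N -> (k + k + m = 8)%N ->
  (T42 N j <= nsums (roots_of_multiples N j) (k + k) 0%R * (2 * N) ^ m)%N.
Proof.
move=> m0 km; apply: leq_trans (T42_nsums N j) _; rewrite -km.
apply: leq_trans (nsums_reduce _ _ _ (roots_of_multiplesN N j)) _.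
by rewrite leq_mul2l leq_exp2r // card_roots_of_multiples orbT.
Qed.

(** Zero sums of length 2 number at most 2N, and six entries are free; 128 is 2 ^ 7. *)
Lemma T42_le7 q N (j : 'F_q) : (T42 N j <= 128 * N ^ 7)%N.
Proof.
apply: leq_trans (@T42_le q N j 1 6 isT erefl) _.
rewrite (_ : 128 * N ^ 7 = 2 * N * (2 * N) ^ 6)%N ?leq_mul2r;
  last by rewrite expnMn; lia.
by rewrite (leq_trans (nsums2_le _ _)) ?card_roots_of_multiples ?orbT.
Qed.

Lemma T42_le6 q N (j : 'F_q) : prime q -> odd q -> j != 0 -> ((4 ^ 2 * N) ^ (2
  ^ 2) < q)%N ->
  (T42 N j <= (2 * 4) ^ 4 * square_pairs N ^ 2 * (2 * N) ^ 4)%N.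
Proof.
move=> q_pr q_odd j0 lt_q; apply: leq_trans (@T42_le q N j 2 4 isT erefl) _.
rewrite leq_mul2r -leq_sqr (expnMn _ (square_pairs N ^ 2) 2) -(expnM
  (square_pairs N) 2 2); apply/orP; right.
exact: nsums_roots_le.
Qed.

Lemma T42_le5 q N (j : 'F_q) : prime q -> odd q -> j != 0 -> ((6 ^ 2 * N) ^ (2
  ^ 4) < q)%N ->
  (T42 N j <= (2 * 6) ^ 6 * square_pairs N ^ 3 * (2 * N) ^ 2)%N.
Proof.
move=> q_pr q_odd j0 lt_q; apply: leq_trans (@T42_le q N j 3 2 isT erefl) _.
rewrite leq_mul2r -leq_sqr (expnMn _ (square_pairs N ^ 3) 2) -(expnM
  (square_pairs N) 3 2); apply/orP; right.
exact: nsums_roots_le.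
Qed.

(** * Logarithms and powers of N *)

Lemma harmonic_le_ln (R : realType) N : (0 < N)%N ->
  \sum_(g < N) g.+1%:R^-1 <= 1 + ln N%:R :> R.
Proof.
case: N => // N _; elim: N => [|N IH];
  first by rewrite big_ord1 invr1 ln1 addr0.
rewrite big_ord_recr /=; apply: le_trans (lerD IH (lexx _)) _.
rewrite -addrA lerD2l -lerBrDl -[X in X <= _]opprK lerNl opprB.
rewrite -ln_div ?posrE ?ltr0n //.
(* With m = N + 2, the new term 1 / m is at most - ln (1 - 1 / m). *)
have -> : N.+1%:R / N.+2%:R = 1 + - N.+2%:R^-1 :> R.
  by apply: (mulIf (x := N.+2%:R));
    rewrite ?pnatr_eq0 // mulrDl mulNr !mulVf ?pnatr_eq0 //
     divfK ?pnatr_eq0 // -[in RHS]natr1; ring.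
by apply: le_ln1Dx; rewrite ltrN2 invf_lt1 ?ltr0n // ltr1n.
Qed.

Lemma square_pairs_le (R : realType) N : (0 < N)%N ->
  (square_pairs N)%:R <= N%:R * (1 + ln N%:R) :> R.
Proof.
move=> N0; apply: le_trans (ler_wpM2l (ler0n _ _) (harmonic_le_ln R N0)).
apply: (@le_trans _ _ (\sum_(g < N) N %/ g.+1)%N%:R).
  by rewrite ler_nat card_square_pairs.
rewrite natr_sum mulr_sumr; apply: ler_sum => g _.
by rewrite ler_pdivlMr ?ltr0n // -natrM ler_nat leq_divM.
Qed.

(** With a = eps / 6, 1 + ln N is at most a constant times N ^ a. The cube uses up N ^ (eps / 2),
    and the other half of eps absorbs the constant D. *)
Lemma ln_cube_le_powR (R : realType) (C eps : R) : 0 <= C -> 0 < eps ->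
  exists N0 : nat, forall N : nat, (0 < N)%N -> (N0 <= N)%N ->
    C * (1 + ln N%:R) ^+ 3 <= N%:R `^ eps.
Proof.
move=> C0 eps0; pose a := eps / 6; have a0 : 0 < a by rewrite divr_gt0.
pose D := C * (1 + a^-1) ^+ 3.
have D0 : 0 <= D by rewrite mulr_ge0 // exprn_ge0 // addr_ge0 // invr_ge0 ltW.
exists (Num.bound (D `^ (eps / 2)^-1)) => N N0 leN.
have N1 : 1 <= N%:R :> R by rewrite ler1n.
have Na1 : 1 <= N%:R `^ a by rewrite -[X in X <= _](powRr0 N%:R) ler_powR //
  ltW.
have ln0 : 0 <= 1 + ln N%:R :> R by apply: addr_ge0 => //; apply: ln_ge0.
have lnle : 1 + ln N%:R <= (1 + a^-1) * N%:R `^ a.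
  rewrite mulrDl mul1r; apply: lerD => //;
    rewrite -ler_pdivrMl ?invr_gt0 // invrK.
  by rewrite -ln_powR ltW // ln_sublinear // powR_gt0 // ltr0n.
have DN : D <= N%:R `^ (eps / 2).
  have -> : D = (D `^ (eps / 2)^-1) `^ (eps / 2).
    by rewrite -powRrM mulVf ?powRr1 // gt_eqF // divr_gt0.
  rewrite ge0_ler_powR ?nnegrE ?powR_ge0 ?ler0n //;
    first by rewrite ltW // divr_gt0.
  by rewrite (le_trans (ltW (archi_boundP (powR_ge0 _ _)))) // ler_nat.
have -> : N%:R `^ eps = N%:R `^ (eps / 2) * N%:R `^ a ^+ 3.
  rewrite -powR_mulrn ?powR_ge0 // -powRrM -powRD; first by congr powR;
    rewrite /a; field.
  by rewrite pnatr_eq0 -lt0n N0 implybT.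
apply: le_trans (ler_wpM2r _ DN); last by rewrite exprn_ge0 ?powR_ge0.
rewrite -mulrA -exprMn ler_wpM2l // lerXn2r ?nnegrE //.
by rewrite (le_trans ln0).
Qed.

Lemma powR_half_le (R : realType) (x y : R) : 0 <= x -> 0 <= y -> x <= y ^+ 2 ->
  x `^ (1 / 2) <= y.
Proof.
move=> x0 y0 xy; rewrite div1r powR12_sqrt //.
by rewrite -[y]ger0_norm // -sqrtr_sqr ler_sqrt // exprn_ge0.
Qed.

Theorem theorem1p2 (R : realType) (eps : R) (heps : 0 < eps) :
  exists N0 : nat, forall (q N : nat) (j : 'F_q),
    prime q -> j != 0 -> (0 < N)%N -> (N <= q)%N -> (N0 <= N)%N ->
    (T42 N j)%:R <=
      (N%:R `^ (5 / 8) / q%:R `^ (1 / 8) + N%:R ^+ 8 / q%:R `^ (1 / 2))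
        * N%:R `^ (6 + eps)
      + N%:R `^ (5 + eps) :> R.
Proof.
(* This is 6 ^ 16 * 2 ^ 16, the constant of the middle range of q; it exceeds 128 and 12 ^ 6 * 2 ^
   2, those of the other two. *)
pose K : R := 12 ^+ 16.
have K0 : 0 <= K by rewrite exprn_ge0.
have [N1 N1P] := ln_cube_le_powR K0 heps.
(* N >= 4 ensures (16 N) ^ 4 <= N ^ 14, and also that a prime q > N ^ 14 is odd. *)
exists (maxn 4 N1) => q N j q_pr j0 N0 _; rewrite geq_max => /andP[N4 leN1].
have {}N1P := N1P N N0 leN1.
have N_gt0 : 0 < N%:R :> R by rewrite ltr0n.
have q_gt0 : 0 < q%:R :> R by rewrite ltr0n prime_gt0.
have S_le := square_pairs_le R N0.
pose L : R := 1 + ln N%:R; rewrite -/L in N1P S_le.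
have L1 : 1 <= L by rewrite lerDl ln_ge0 // ler1n.
have powD (n : nat) : N%:R `^ (n%:R + eps) = N%:R ^+ n * N%:R `^ eps.
  by rewrite powRD ?powR_mulrn ?ler0n // pnatr_eq0 -lt0n N0 implybT.
set x : R := N%:R in N_gt0 S_le N1P powD *.
set s : R := q%:R `^ (1 / 2).
have s_gt0 : 0 < s by rewrite powR_gt0.
have A_ge0 : 0 <= x `^ (5 / 8) / q%:R `^ (1 / 8) by rewrite divr_ge0 ?powR_ge0.
rewrite !powD; set E := x `^ eps in N1P *.
have E0 : 0 <= E by rewrite powR_ge0.
have LE n : (n <= 3)%N -> K * L ^+ n <= E.
  by move=> n3; apply: le_trans N1P; rewrite ler_wpM2l // ler_weXn2l.
have main (t : R) : t <= x ^+ 8 / s * (x ^+ 6 * E) + x ^+ 5 * E ->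
    t <= (x `^ (5 / 8) / q%:R `^ (1 / 8) + x ^+ 8 / s) * (x ^+ 6 * E) + x ^+ 5
      * E.
  move=> /le_trans; apply; rewrite lerD2r ler_wpM2r ?lerDr //.
  by rewrite mulr_ge0 // exprn_ge0.
apply: main.
have s_le (y : R) : 0 <= y -> q%:R <= y ^+ 2 -> s <= y by move=> *;
  apply: powR_half_le.
(* For q <= N ^ 14, sqrt q <= N ^ 7, so N ^ 14 / sqrt q is at least N ^ 7. *)
have [q_small|q_big] := leqP q (N ^ 14).
  have sx : s <= x ^+ 7.
    apply: s_le; first by rewrite exprn_ge0.
    by rewrite -exprM /x -natrX ler_nat.
  have T_le : (T42 N j)%:R <= 128 * x ^+ 7 :> R.
    by rewrite /x -natrX -natrM ler_nat T42_le7.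
  have E_ge : 128 <= E.
    by apply: le_trans (LE 0%N isT); rewrite expr0 mulr1 /K; lra.
  apply: le_trans T_le _; rewrite -[X in X <= _]addr0; apply: lerD; last first.
    by rewrite mulr_ge0 // exprn_ge0.
  apply: (@le_trans _ _ (x * (x ^+ 6 * E))).
    by rewrite mulrA -exprS mulrC ler_wpM2l // exprn_ge0.
  rewrite ler_wpM2r ?mulr_ge0 ?exprn_ge0 //.
  by rewrite ler_pdivlMr // exprS ler_wpM2l.
have q_odd : odd q.
  case: (even_prime q_pr) => // q2; move: q_big; rewrite q2 ltnNge => /negP[].
  by rewrite (leq_trans _ (leq_pexp2l N0 (isT : 1 <= 14)%N)) // expn1
    (leq_trans _ N4).
have expand (c t n a b : nat) :
    (c * t ^ a * (2 * n) ^ b)%N%:R = c%:R * t%:R ^+ a * (2 * n%:R) ^+ b :> R.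
  by rewrite natrM natrM natrX natrX natrM.
(* For q <= (36 N) ^ 16, sqrt q <= 6 ^ 16 * N ^ 8, so N ^ 14 / sqrt q is at least N ^ 6 / 6 ^ 16. *)
have [q_mid|q_large] := leqP q ((6 ^ 2 * N) ^ (2 ^ 4)).
  have T_le : (T42 N j)%:R <= (2 * 4) ^+ 4 * (x * L) ^+ 2 * (2 * x) ^+ 4.
    apply: (@le_trans _ _ ((2 * 4) ^ 4 * square_pairs N ^ 2 * (2 * N) ^
      4)%N%:R).
      rewrite ler_nat T42_le6 // (leq_ltn_trans _ q_big) //.
      rewrite expnMn -[14%N]/(10 + 4)%N expnD leq_mul2r; apply/orP; right.
      by rewrite (leq_trans _ (_ : 4 ^ 10 <= N ^ 10)%N) ?leq_exp2r.
    rewrite expand (natrX _ (2 * 4) 4) natrM ler_wpM2r ?exprn_ge0 ?mulr_ge0 //.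
    by rewrite ler_wpM2l ?exprn_ge0 ?mulr_ge0 // lerXn2r ?nnegrE ?mulr_ge0 //
      (le_trans _ L1).
  have sx : s <= 6 ^+ 16 * x ^+ 8.
    apply: s_le; first by rewrite mulr_ge0 ?exprn_ge0.
    have -> : (6 ^+ 16 * x ^+ 8) ^+ 2 = (6 ^+ 2 * x) ^+ 16 by ring.
    rewrite /x -(natrX _ 6 2) -natrM -natrX ler_nat; exact: q_mid.
  apply: le_trans T_le _; rewrite -[X in X <= _]addr0; apply: lerD; last first.
    by rewrite mulr_ge0 // exprn_ge0.
  have xs : 1 <= 6 ^+ 16 * (x ^+ 8 / s) by rewrite mulrA ler_pdivlMr // mul1r.
  have -> : (2 * 4) ^+ 4 * (x * L) ^+ 2 * (2 * x) ^+ 4 = x ^+ 6 * (2 ^+ 16 * L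
    ^+ 2) by ring.
  rewrite [leRHS]mulrCA ler_wpM2l ?exprn_ge0 //.
  apply: (@le_trans _ _ (x ^+ 8 / s * (K * L ^+ 2))); last first.
    by rewrite ler_wpM2l ?LE // divr_ge0 ?exprn_ge0 // ltW.
  have -> : x ^+ 8 / s * (K * L ^+ 2) = (6 ^+ 16 * (x ^+ 8 / s)) * (2 ^+ 16 * L
    ^+ 2).
    by rewrite /K; ring.
  by rewrite ler_peMl // mulr_ge0 ?exprn_ge0 // (le_trans _ L1).
(* For larger q, length 6 gives a constant times N ^ 5 L ^ 3, which goes into the last term. *)
apply: (@le_trans _ _ ((2 * 6) ^+ 6 * (x * L) ^+ 3 * (2 * x) ^+ 2)).
  apply: (@le_trans _ _ ((2 * 6) ^ 6 * square_pairs N ^ 3 * (2 * N) ^ 2)%N%:R).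
    by rewrite ler_nat T42_le5.
  rewrite expand (natrX _ (2 * 6) 6) natrM ler_wpM2r ?exprn_ge0 ?mulr_ge0 //.
  by rewrite ler_wpM2l ?exprn_ge0 ?mulr_ge0 // lerXn2r ?nnegrE ?mulr_ge0 //
    (le_trans _ L1).
rewrite -[X in X <= _]add0r; apply: lerD.
  by rewrite !mulr_ge0 ?exprn_ge0 // invr_ge0 ltW.
have -> : (2 * 6) ^+ 6 * (x * L) ^+ 3 * (2 * x) ^+ 2 = x ^+ 5 * ((2 * 6) ^+ 6 *
  2 ^+ 2 * L ^+ 3) by ring.
rewrite ler_wpM2l ?exprn_ge0 // (le_trans _ (LE 3%N isT)) // ler_wpM2r
  ?exprn_ge0 ?(le_trans _ L1) //.
by rewrite /K; lra.
Qed.
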